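(* Let Assumptions 1 and 2 (stated in the context) hold and let $g',g''\in L^2[0,1]$. Put $C_1=(\tilde x_2-\tilde x_1)^{1/2}/\min\{\tilde x_1-x_1,\ x_2-\tilde x_2\}$, $c_p=\min\{1-w_2,w_1\}\min\{C_F-1,2\}c_Wc_f/4$ and $\bar C=C_1/c_p$. If there exists $h\in L^2[0,1]$ such that $g'-g''+h\in\mathcal M$ and $$\|h\|_{2,t}+\bar C\|T\|_2\|h\|_2<\|g'-g''\|_{2,t},$$ then $g'$ and $g''$ are not observationally equivalent, i.e. it is not the case that $E[g'(X)-g''(X)\mid W]=0$ almost surely (equivalently, $\|T(g'-g'')\|_2>0$).
   Context: Let $(X,W)$ be a random pair with values in $[0,1]^2$; $F_{X|W}(x|w)$, $f_{X|W}(x|w)$, $f_{X,W}$, $f_W$ denote the conditional distribution function of $X$ given $W=w$, the conditional density, the joint density and the marginal density of $W$. Fix constants $0\le x_1<\tilde x_1<\tilde x_2<x_2\le1$ and $0<w_1<w_2<1$. ''Increasing'' means non-decreasing and ''decreasing'' means non-increasing. Assumption 1 (Monotone IV): (a) for all $x,w',w''\in(0,1)$ with $w'\le w''$, $F_{X|W}(x|w')\ge F_{X|W}(x|w'')$; (b) there is a constant $C_F>1$ such that $F_{X|W}(x|w_1)\ge C_F F_{X|W}(x|w_2)$ for all $x\in(0,x_2)$, and $C_F(1-F_{X|W}(x|w_1))\le 1-F_{X|W}(x|w_2)$ for all $x\in(x_1,1)$. Assumption 2 (Density): (i) $(X,W)$ has a density $f_{X,W}$ with respect to Lebesgue measure on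 $[0,1]^2$ with $\int_0^1\int_0^1 f_{X,W}(x,w)^2\,dx\,dw\le C_T$ for a finite constant $C_T$; (ii) there is $c_f>0$ with $f_{X|W}(x|w)\ge c_f$ for all $x\in[x_1,x_2]$ and $w\in\{w_1,w_2\}$; (iii) there are constants $0<c_W\le C_W<\infty$ with $c_W\le f_W(w)\le C_W$ for all $w\in[0,1]$. The operator $T:L^2[0,1]\to L^2[0,1]$ is $(Th)(w)=E[h(X)\mid W=w]f_W(w)=\int_0^1 h(x)f_{X,W}(x,w)\,dx$, with operator norm $\|T\|_2=\sup_{\|h\|_2=1}\|Th\|_2$. The truncated norm is $\|h\|_{2,t}=\big(\int_{\tilde x_1}^{\tilde x_2}h(x)^2dx\big)^{1/2}$. $\mathcal M$ denotes the set of all monotone (increasing or decreasing) functions in $L^2[0,1]$. *)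

(* Defs.v *)
From HB Require Import structures.
From mathcomp Require Import all_boot all_order all_algebra.
From mathcomp Require Import all_classical all_reals all_analysis.
Set Implicit Arguments. Unset Strict Implicit. Unset Printing Implicit Defensive.
Import Order.TTheory GRing.Theory Num.Theory.
Import numFieldNormedType.Exports.
Local Open Scope classical_set_scope.
Local Open Scope ring_scope.

Section Defs.
Variable R : realType.
Notation leb := (@lebesgue_measure R).

Definition I01 : set R := `[0%R, 1%R].

Definition inL2 (h : R -> R) : Prop :=
  measurable_fun I01 h /\
  (\int[leb]_(x in I01) ((h x) ^+ 2)%:E < +oo)%E.

Definition L2norm (h : R -> R) : R :=
  Num.sqrt (fine (\int[leb]_(x in I01) ((h x) ^+ 2)%:E)).
Definition L2norm_on (a b : R) (h : R -> R) : R :=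
  Num.sqrt (fine (\int[leb]_(x in `[a, b]) ((h x) ^+ 2)%:E)).

Definition is_joint_density (f : R -> R -> R) : Prop :=
  measurable_fun setT (fun p : R * R => f p.1 p.2) /\
  (forall x w, I01 x -> I01 w -> 0 <= f x w) /\
  (\int[leb]_(w in I01) (\int[leb]_(x in I01) (f x w)%:E)%E = 1)%E.

Definition fW (f : R -> R -> R) (w : R) : R :=
  fine (\int[leb]_(x in I01) (f x w)%:E).

Definition f_cond (f : R -> R -> R) (x w : R) : R := f x w / fW f w.

Definition F_cond (f : R -> R -> R) (x w : R) : R :=
  fine (\int[leb]_(t in `[0%R, x]) (f t w)%:E) / fW f w.

Definition Top (f : R -> R -> R) (h : R -> R) (w : R) : R :=
  fine (\int[leb]_(x in I01) (h x * f x w)%:E).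

Definition condE (f : R -> R -> R) (h : R -> R) (w : R) : R :=
  Top f h w / fW f w.

Definition Topnorm (f : R -> R -> R) : \bar R :=
  ereal_sup [set (L2norm (Top f h))%:E | h in [set h | inL2 h /\ L2norm h = 1]].

Definition monotone_on01 (m : R -> R) : Prop :=
  (forall x y, I01 x -> I01 y -> x <= y -> m x <= m y) \/
  (forall x y, I01 x -> I01 y -> x <= y -> m y <= m x).
Definition inM (g : R -> R) : Prop :=
  inL2 g /\ exists m, monotone_on01 m /\
    {ae leb, forall x, I01 x -> g x = m x}.

Definition Assumption1 (f : R -> R -> R) (x1 x2 w1 w2 CF : R) : Prop :=
  (forall x w' w'', 0 < x < 1 -> 0 < w' < 1 -> 0 < w'' < 1 -> w' <= w'' ->
      F_cond f x w' >= F_cond f x w'') /\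
  1 < CF /\
  (forall x, 0 < x < x2 -> F_cond f x w1 >= CF * F_cond f x w2) /\
  (forall x, x1 < x < 1 -> CF * (1 - F_cond f x w1) <= 1 - F_cond f x w2).

Definition Assumption2 (f : R -> R -> R) (x1 x2 w1 w2 CT cf cW CW : R) : Prop :=
  is_joint_density f /\
  (\int[leb]_(w in I01) (\int[leb]_(x in I01) ((f x w) ^+ 2)%:E)%E <= CT%:E)%E /\
  0 < cf /\
  (forall x w, x1 <= x <= x2 -> (w = w1 \/ w = w2) -> f_cond f x w >= cf) /\
  0 < cW /\ cW <= CW /\
  (forall w, I01 w -> cW <= fW f w <= CW).

End Defs.

(* Main.v *)
(* Write [m := g' - g'' + h] (a.e. monotone, say nondecreasing) and let
   [M w := E[m(X) | W = w]].  Stochastic dominance makes [M] nondecreasing, and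
   Assumption 1(b) makes [E[m^+(X) | W = w]] grow, respectively
   [E[m^-(X) | W = w]] shrink, by the factor [CF] between [w1] and [w2] as soon
   as [m] is nonpositive somewhere right of [x1], respectively nonnegative
   somewhere left of [x2].  Hence [max (M w2) (- M w1)] is bounded below by a
   multiple of [m^+(tx2) + m^-(tx1)], which dominates [|m|] on [tx1, tx2]; since
   [M] is monotone this bounds [T m] from below on [w2, 1) or on (0, w1], so
   that [||m||_{2,t} <= Cbar ||T m||_2].  If [T (g' - g'') = 0] then
   [T m = T h], and the triangle inequality contradicts the hypothesis. *)
Require Import Defs.
From HB Require Import structures.
From mathcomp Require Import all_boot all_order all_algebra.
From mathcomp Require Import all_classical all_reals all_analysis.
From mathcomp Require Import measurable_realfun ring lra.
Import Order.TTheory GRing.Theory Num.Theory.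
Import numFieldNormedType.Exports.
Set Implicit Arguments.
Unset Strict Implicit.
Local Open Scope classical_set_scope.
Local Open Scope ring_scope.

(** * Comparing weighted integrals through level sets *)

(** Each level [d], [2d], ..., [Nd] reached by [y] contributes one step of height [d], so the sum is
    [y] rounded down to a multiple of [d]. This is a finite layer-cake formula. *)
Lemma staircase (R : realType) (d y : R) (N : nat) : 0 < d -> 0 <= y -> y < d *+ N ->
  let S := \sum_(j < N) d * (d *+ j.+1 <= y)%R%:R in S <= y <= S + d.
Proof.
move=> d0 y0.
pose S n := \sum_(j < n) d * (d *+ j.+1 <= y)%R%:R.
suff H n : (d *+ n <= y -> S n = d *+ n) /\ (y < d *+ n -> S n <= y <= S n + d).
  by move=> yN; exact: (H N).2.
elim: n => [|n [IH1 IH2]].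
  by split=> [_|]; rewrite /S ?big_ord0 mulr0n// ltNge y0.
have SS : S n.+1 = S n + d * (d *+ n.+1 <= y)%R%:R by rewrite /S big_ord_recr.
have dS : d *+ n.+1 = d *+ n + d by rewrite mulrSr.
split=> h.
  by rewrite SS h mulr1 IH1 ?dS//; move: h; rewrite dS; lra.
rewrite SS (leNgt (d *+ n.+1)) h mulr0 addr0.
have [yn|yn] := leP (d *+ n) y; last exact: IH2.
by rewrite IH1// yn /= -dS ltW.
Qed.

Section LevelSets.
Context (d : measure_display) (T : measurableType d) (R : realType).
Variables (mu : {measure set T -> \bar R}) (D : set T).
Hypothesis mD : measurable D.
Implicit Types (p q k : T -> R).

Lemma integrable_bounded_mul k p (B : R) :
  measurable_fun D k -> (forall x, D x -> `|k x| <= B) ->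
  mu.-integrable D (EFin \o p) ->
  mu.-integrable D (EFin \o (fun x => k x * p x)).
Proof.
move=> mk kB ip.
have mp : measurable_fun D p by apply/measurable_EFinP; exact: measurable_int ip.
apply: (@le_integrable _ _ _ _ _ mD _ (fun x => B%:E * (p x)%:E)%E).
- by apply/measurable_EFinP; exact: measurable_funM.
- move=> x Dx; rewrite /= lee_fin !normrM ler_wpM2r//.
  by rewrite (le_trans (kB x Dx))// ler_norm.
- exact: integrableZl.
Qed.

Lemma integrable_level k p (t : R) : measurable_fun D k ->
  mu.-integrable D (EFin \o p) ->
  mu.-integrable D (EFin \o (fun x => (t <= k x)%R%:R * p x)).
Proof.
move=> mk; have mb : measurable_fun D (fun x => t <= k x)%R.
  exact: measurable_fun_ler.
apply: (@integrable_bounded_mul _ _ 1).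
  rewrite (_ : (fun x => _) =
    (fun x => if (t <= k x)%R then 1 else 0 : R)); last first.
    by apply/funext => x; case: (t <= k x).
  exact: measurable_fun_if.
by move=> x _; case: (t <= k x); rewrite ?normr1 ?normr0.
Qed.

Lemma Rintegral_sum (N : nat) (F : 'I_N -> T -> R) :
  (forall j, mu.-integrable D (EFin \o F j)) ->
  mu.-integrable D (EFin \o (fun x => \sum_(j < N) F j x)) /\
  \int[mu]_(x in D) (\sum_(j < N) F j x) =
  \sum_(j < N) \int[mu]_(x in D) F j x.
Proof.
elim: N F => [|N IH] F iF.
  rewrite big_ord0; split.
    apply: (eq_integrable mD (cst 0%E)); last exact: integrable0.
    by move=> x _; rewrite /= big_ord0.
  under eq_Rintegral do rewrite big_ord0.
  by rewrite Rintegral_cst ?mul0r.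
have [i1 e1] := IH (fun j => F (widen_ord (leqnSn N) j)) (fun j => iF _).
split.
  apply: (eq_integrable mD
    (fun x => (\sum_(j < N) F (widen_ord (leqnSn N) j) x)%R%:E +
      (F ord_max x)%:E)%E).
    by move=> x _; rewrite /= big_ord_recr.
  by have := integrableD mD i1 (iF ord_max).
under eq_Rintegral do rewrite big_ord_recr.
by rewrite RintegralD// e1 big_ord_recr.
Qed.

(** Layer cake: up to an error [u], [k] is a sum of indicators of its level sets weighted by [u].
    The hypothesis applies level by level, and the error vanishes as [u] tends to 0. *)
Lemma level_set_dominance p q k (B C : R) :
  mu.-integrable D (EFin \o p) -> mu.-integrable D (EFin \o q) ->
  (forall x, D x -> 0 <= p x) -> (forall x, D x -> 0 <= q x) ->
  measurable_fun D k -> (forall x, D x -> 0 <= k x <= B) -> 0 <= C ->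
  (forall t : R, 0 < t ->
    C * \int[mu]_(x in D) ((t <= k x)%R%:R * q x) <=
    \int[mu]_(x in D) ((t <= k x)%R%:R * p x)) ->
  C * \int[mu]_(x in D) (k x * q x) <= \int[mu]_(x in D) (k x * p x).
Proof.
move=> ip iq p0 q0 mk kB C0 H.
have it r t := @integrable_level k r t mk.
have ik (r : T -> R) : mu.-integrable D (EFin \o r) ->
    mu.-integrable D (EFin \o (fun x => k x * r x)).
  apply: (integrable_bounded_mul (B := B)) => // x /kB/andP[k0 kb].
  by rewrite ger0_norm.
have idt (r : T -> R) (u : R) t : mu.-integrable D (EFin \o r) ->
    mu.-integrable D (EFin \o (fun x => u * ((t <= k x)%R%:R * r x))).
  by move=> ir; have := integrableZl mD u (it r t ir).
have Q0 : 0 <= \int[mu]_(x in D) q x by apply: Rintegral_ge0.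
(* Rounding [k] down on the [p] side is free; on the [q] side it costs at most [u] times the
   integral of [q]. *)
suff step (u : R) : 0 < u -> C * \int[mu]_(x in D) (k x * q x) <=
    \int[mu]_(x in D) (k x * p x) + C * (u * \int[mu]_(x in D) q x).
  apply/ler_addgt0Pr => e e0.
  have D0 : 0 < C * \int[mu]_(x in D) q x + 1 by rewrite ltr_wpDl// mulr_ge0.
  (* This [u] makes the error at most [e]; the added 1 keeps the denominator positive. *)
  have := step (e / (C * \int[mu]_(x in D) q x + 1)) (divr_gt0 e0 D0).
  move=> /le_trans; apply; rewrite lerD2l mulrCA -mulrA ler_piMr ?(ltW e0)//.
  by rewrite ler_pdivrMl// mulr1 lerDl.
move=> u0.
(* Enough levels to exceed the bound [B], so that the staircase covers the whole range of [k]. *)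
have [N BN] : exists N : nat, B < u *+ N.
  exists (Num.trunc (B / u)).+1; rewrite -mulr_natr mulrC -ltr_pdivrMr//.
  exact: truncnS_gt.
have st x : D x -> let S := \sum_(j < N) u * (u *+ j.+1 <= k x)%R%:R in
    S <= k x <= S + u.
  move=> /kB/andP[k0 kb]; apply: staircase => //; exact: le_lt_trans BN.
have [iSp eSp] := Rintegral_sum (fun j : 'I_N => idt p u (u *+ j.+1) ip).
have [iSq eSq] := Rintegral_sum (fun j : 'I_N => idt q u (u *+ j.+1) iq).
have idq : mu.-integrable D (EFin \o (fun x => u * q x)).
  by have := integrableZl mD u iq.
have lp : \sum_(j < N) \int[mu]_(x in D) (u * ((u *+ j.+1 <= k x)%R%:R * p x))
    <= \int[mu]_(x in D) (k x * p x).
  rewrite -eSp; apply: le_Rintegral => //; first exact: ik.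
  move=> x Ix; under eq_bigr do rewrite mulrA.
  by rewrite -mulr_suml ler_wpM2r ?p0//; have /andP[] := st x Ix.
have lq : \int[mu]_(x in D) (k x * q x) <=
    \sum_(j < N) \int[mu]_(x in D) (u * ((u *+ j.+1 <= k x)%R%:R * q x)) +
    u * \int[mu]_(x in D) q x.
  rewrite -eSq -RintegralZl// -RintegralD//; apply: le_Rintegral => //.
  - exact: ik.
  - by have := integrableD mD iSq idq.
  move=> x Ix; under eq_bigr do rewrite mulrA.
  by rewrite -mulr_suml -mulrDl ler_wpM2r ?q0//; have /andP[] := st x Ix.
apply: le_trans (ler_wpM2l C0 lq) _.
rewrite mulrDr lerD2r; apply: le_trans lp.
rewrite mulr_sumr; apply: ler_sum => j _.
rewrite !RintegralZl//; [|exact: it..].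
by rewrite mulrCA ler_wpM2l ?(ltW u0)// H// mulrn_wgt0.
Qed.

End LevelSets.

(** * Monotone functions and stochastic dominance on the unit interval *)

Section UnitInterval.
Context {R : realType}.
Notation leb := (@lebesgue_measure R).
Notation I01 := (@I01 R).
Implicit Types (p q k : R -> R).

Definition nondecreasing01 k :=
  forall x y, I01 x -> I01 y -> x <= y -> k x <= k y.
Definition nonincreasing01 k :=
  forall x y, I01 x -> I01 y -> x <= y -> k y <= k x.

Lemma I01E (x : R) : I01 x = (0 <= x <= 1) :> Prop.
Proof. by rewrite /Defs.I01 /= in_itv. Qed.

Lemma measurable_I01 : measurable I01.
Proof. exact: measurable_itv. Qed.

Lemma nondecreasing01_measurable k :
  nondecreasing01 k -> measurable_fun I01 k.
Proof.
(* Clamping to the unit interval extends [k] to a nondecreasing function on the whole line. *)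
move=> kh; pose c (x : R) := Num.max 0 (Num.min 1 x).
have cI x : I01 (c x) 
  by rewrite I01E /c le_max lexx /= ge_max ler01 ge_min lexx.
apply: (@eq_measurable_fun _ _ _ _ _ (k \o c)).
  move=> x /set_mem; rewrite I01E => xI /=; congr k.
  by rewrite /c; move/andP: xI => [x0 x1]; rewrite min_r// max_r.
apply: nondecreasing_measurable; first exact: measurable_I01.
move=> x y xy; apply: kh => //.
by rewrite /c ge_max !le_max lexx /= le_min !ge_min lexx xy !orbT.
Qed.

Lemma nonincreasing01_measurable k :
  nonincreasing01 k -> measurable_fun I01 k.
Proof.
move=> kh; rewrite -[k]opprK; apply: measurableT_comp => //.
by apply: nondecreasing01_measurable => x y Ix Iy xy; rewrite lerN2; exact: kh.
Qed.

(** The cut is the infimum of [U] within the unit interval, or 1 if [U] has no point there.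
    Membership of [s] itself stays open, which is harmless since integrals ignore a point. *)
Lemma upper_set_cut (U : set R) :
  (forall x y, I01 x -> I01 y -> x <= y -> U x -> U y) ->
  exists s, [/\ 0 <= s <= 1, forall x, I01 x -> s < x -> U x &
    forall x, I01 x -> x < s -> ~ U x].
Proof.
move=> upU; have [[z [zI Uz]]|noU] := pselect (exists z, I01 z /\ U z); last first.
  exists 1; split; first by rewrite ler01 lexx.
    by move=> x; rewrite I01E => /andP[_ x1]; rewrite ltNge x1.
  by move=> x xI _ Ux; apply: noU; exists x.
pose V := I01 `&` U.
have V0 : V !=set0 by exists z.
have lbV : lbound V 0 by move=> x []; rewrite I01E => /andP[].
have hV : has_inf V by split => //; exists 0.
exists (inf V); split.
- rewrite lb_le_inf//=; apply: (@le_trans _ _ z).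
    by apply: ge_inf; [exists 0|].
  by move: zI; rewrite I01E => /andP[].
- move=> x xI sx; have e0 : 0 < x - inf V by rewrite subr_gt0.
  have [v [vI Uv]] := inf_adherent e0 hV.
  by rewrite addrC subrK => /ltW vx; exact: upU Uv.
- move=> x xI xs Ux; move: xs; rewrite ltNge => /negP; apply.
  by apply: ge_inf; [exists 0|].
Qed.

Lemma Rintegral_upper_set p (b : R -> bool) (s : R) :
  leb.-integrable I01 (EFin \o p) ->
  leb.-integrable I01 (EFin \o (fun x => (b x)%:R * p x)) -> 0 <= s <= 1 ->
  (forall x, I01 x -> s < x -> b x) -> (forall x, I01 x -> x < s -> ~ b x) ->
  \int[leb]_(x in I01) ((b x)%:R * p x) =
  \int[leb]_(x in I01) p x - \int[leb]_(x in `[0, s]) p x.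
Proof.
move=> ip ibp /andP[s0 s1] bT bF.
rewrite (@Rintegral_itvB _ p (BLeft 0) (BRight 1) s)//.
have := @Rintegral_itvB _ _ (BLeft 0) (BRight 1) s ibp.
move=> /(_ _ _)/esym; rewrite !bnd_simp => /(_ s0 s1) e.
apply/eqP; rewrite -subr_eq0; apply/eqP.
have -> : \int[leb]_(x in `]s, 1]) p x = \int[leb]_(x in `]s, 1]) ((b x)%:R * p x).
  apply: eq_Rintegral => x /set_mem /=; rewrite in_itv /= => /andP[sx x1].
  by rewrite bT ?mul1r// I01E x1 (le_trans s0 (ltW sx)).
rewrite e opprB addrC subrK.
(* The value of [b] at [s] is undetermined, so this null point is dropped before the integrand is
   replaced by 0. *)
rewrite -Rintegral_itv_bndo_bndc; last first.
  apply: integrableS ibp => //; first exact: measurable_I01.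
  by move=> x /=; rewrite I01E in_itv /= => /andP[-> /ltW/le_trans]; exact.
rewrite (@eq_Rintegral _ _ _ _ _ (cst 0)) ?Rintegral_cst ?mul0r//.
move=> x /set_mem /=; rewrite in_itv /= => /andP[x0 xs].
have /negP/negPf -> : ~ b x by apply: bF => //; rewrite I01E x0 (le_trans (ltW xs)).
by rewrite mul0r.
Qed.

Section Dominance.
Variables (p q : R -> R) (C : R).
Hypotheses (ip : leb.-integrable I01 (EFin \o p))
  (iq : leb.-integrable I01 (EFin \o q))
  (p0 : forall x, I01 x -> 0 <= p x) (q0 : forall x, I01 x -> 0 <= q x)
  (C0 : 0 <= C).

(** The positive level sets of a nondecreasing [k] are right-hand intervals up to an endpoint. They
    start no earlier than [y], so comparing tail integrals from [y] on is enough. *)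
Lemma dominance_upper k (y : R) :
  nondecreasing01 k -> (forall x, I01 x -> 0 <= k x) ->
  (forall x, I01 x -> x < y -> k x = 0) -> y <= 1 ->
  (forall s, 0 <= s <= 1 -> y <= s ->
    C * (\int[leb]_(x in I01) q x - \int[leb]_(x in `[0, s]) q x) <=
    \int[leb]_(x in I01) p x - \int[leb]_(x in `[0, s]) p x) ->
  C * \int[leb]_(x in I01) (k x * q x) <= \int[leb]_(x in I01) (k x * p x).
Proof.
move=> kh k0 ky y1 H; have mk := nondecreasing01_measurable kh.
apply: (@level_set_dominance _ _ _ _ _ _ _ _ _ (k 1)) => //.
- exact: measurable_I01.
- move=> x xI; rewrite k0//= kh//; first by rewrite I01E ler01 lexx.
  by move: xI; rewrite I01E => /andP[].
move=> t t0.
have [s [sI sU sL]] : exists s, [/\ 0 <= s <= 1,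
    forall x, I01 x -> s < x -> t <= k x &
    forall x, I01 x -> x < s -> ~ (t <= k x)].
  apply: (@upper_set_cut [set x | t <= k x]) => x z Ix Iz xz /= tx.
  by rewrite (le_trans tx)// kh.
rewrite !(@Rintegral_upper_set _ _ s)//; [|exact: (@integrable_level _ _ _ leb I01 measurable_I01)..].
apply: H => //; rewrite leNgt; apply/negP => sy.
have /andP[s0 s1] := sI.
(* If [s < y], the midpoint lies right of [s], where [k] is at least [t > 0], and left of [y], where
   [k] vanishes. *)
have xI : I01 ((s + y) / 2) by rewrite I01E; apply/andP; split; lra.
have := sU _ xI; rewrite ky//; last by lra.
have sm : s < (s + y) / 2 by lra.
by move=> /(_ sm); rewrite leNgt t0.
Qed.

(** Mirror image: the complements of the level sets are upper sets, so the level sets are initial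
    intervals ending no later than [y]. *)
Lemma dominance_lower k (y : R) :
  nonincreasing01 k -> (forall x, I01 x -> 0 <= k x) ->
  (forall x, I01 x -> y < x -> k x = 0) -> 0 <= y ->
  (forall s, 0 <= s <= 1 -> s <= y ->
    C * \int[leb]_(x in `[0, s]) q x <= \int[leb]_(x in `[0, s]) p x) ->
  C * \int[leb]_(x in I01) (k x * q x) <= \int[leb]_(x in I01) (k x * p x).
Proof.
move=> kh k0 ky y0 H; have mk := nonincreasing01_measurable kh.
apply: (@level_set_dominance _ _ _ _ _ _ _ _ _ (k 0)) => //.
- exact: measurable_I01.
- move=> x xI; rewrite k0//= kh//; first by rewrite I01E ler01 lexx.
  by move: xI; rewrite I01E => /andP[].
move=> t t0.
have [s [sI sU sL]] : exists s, [/\ 0 <= s <= 1,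
    forall x, I01 x -> s < x -> ~~ (t <= k x) &
    forall x, I01 x -> x < s -> ~ ~~ (t <= k x)].
  apply: (@upper_set_cut [set x | ~~ (t <= k x)]) => x z Ix Iz xz /=.
  by rewrite -!ltNge; apply: le_lt_trans; rewrite kh.
have E r : leb.-integrable I01 (EFin \o r) ->
  \int[leb]_(x in I01) ((t <= k x)%R%:R * r x) = \int[leb]_(x in `[0, s]) r x.
  move=> ir; have il := @integrable_level _ _ _ leb I01 measurable_I01 _ _ t mk ir.
  have nE x : (~~ (t <= k x)%R)%:R * r x = r x - (t <= k x)%R%:R * r x.
    by case: (t <= k x); rewrite ?mul0r ?mul1r ?subrr ?subr0.
  have := @Rintegral_upper_set r (fun x => ~~ (t <= k x)%R) s ir.
  have -> : (fun x => (~~ (t <= k x)%R)%:R * r x) =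
    (fun x => r x - (t <= k x)%R%:R * r x) by apply/funext.
  move=> /(_ _ sI sU sL); rewrite RintegralB//; last exact: measurable_I01.
  move=> e; have /e : leb.-integrable I01
    (EFin \o (fun x => r x - (t <= k x)%R%:R * r x)).
    have := @integrableB _ _ _ leb _ _ _ _ ir il.
    by apply; exact: measurable_I01.
  by move/addrI/oppr_inj.
rewrite !E//; apply: H => //; rewrite leNgt; apply/negP => ys.
have /andP[s0 s1] := sI.
have xI : I01 ((s + y) / 2) by rewrite I01E; apply/andP; split; lra.
have := sL _ xI; rewrite ky//; last by lra.
have sm : (s + y) / 2 < s by lra.
by move=> /(_ sm); rewrite -ltNge t0.
Qed.

End Dominance.
End UnitInterval.

Lemma Rintegral_ge_cst (d : measure_display) (T : measurableType d)
    (R : realType) (mu : {measure set T -> \bar R}) (A D : set T) (g : T -> R)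
    (c : R) :
  measurable A -> measurable D -> A `<=` D -> (mu A < +oo)%E ->
  mu.-integrable D (EFin \o g) -> (forall x, D x -> 0 <= g x) ->
  (forall x, A x -> c <= g x) ->
  c * fine (mu A) <= \int[mu]_(x in D) g x.
Proof.
move=> mA mD AD Afin ig g0 gc.
have ic : mu.-integrable A (EFin \o cst c).
  apply/integrableP; split; first exact/measurable_EFinP.
  under eq_integral do rewrite /=.
  by rewrite integral_cst// lte_mul_pinfty.
have iA : mu.-integrable A (EFin \o g) by exact: integrableS ig.
rewrite -Rintegral_cst//; apply: (le_trans (le_Rintegral mA ic iA gc)).
rewrite /Rintegral fine_le ?integrable_fin_num//.
apply: ge0_subset_integral => //; first exact: measurable_int ig.
Qed.

(** * Conditional densities, distribution functions and expectations *)

Section ConditionalDensity.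
Context {R : realType}.
Notation leb := (@lebesgue_measure R).
Notation I01 := (@I01 R).
Variables (f : R -> R -> R) (cW CW : R).
Hypotheses (mf : measurable_fun setT (fun p : R * R => f p.1 p.2))
  (f0 : forall x w, I01 x -> I01 w -> 0 <= f x w)
  (cW0 : 0 < cW) (fWb : forall w, I01 w -> cW <= fW f w <= CW).

Lemma fW_gt0 w : I01 w -> 0 < fW f w.
Proof. by move=> /fWb/andP[+ _]; exact: lt_le_trans. Qed.

Lemma measurable_section w : measurable_fun setT (f^~ w).
Proof.
by have := measurableT_comp mf (@pair2_measurable _ _ R R w).
Qed.

Lemma integrable_section w : I01 w -> leb.-integrable I01 (EFin \o f^~ w).
Proof.
move=> wI; apply/integrableP; split.
  by apply/measurable_EFinP; apply: measurable_funTS; exact: measurable_section.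
have -> : (\int[leb]_(x in I01) `|(EFin \o f^~ w) x| =
           \int[leb]_(x in I01) (f x w)%:E)%E.
  by apply: eq_integral => x /set_mem xI; rewrite /= ger0_norm// f0.
(* An infinite integral would be sent to 0 by [fine], contradicting [fW f w > 0]. *)
rewrite ltey; apply/eqP => fy.
by have := fW_gt0 wI; rewrite /fW fy ltxx.
Qed.

Lemma integrable_f_cond w : I01 w ->
  leb.-integrable I01 (EFin \o f_cond f ^~ w).
Proof.
move=> wI; have := @integrableZr _ _ _ leb _ _ (fW f w)^-1 _ (integrable_section wI).
by apply; exact: measurable_I01.
Qed.

Lemma f_cond_ge0 w x : I01 w -> I01 x -> 0 <= f_cond f x w.
Proof. by move=> wI xI; rewrite divr_ge0 ?f0// ltW ?fW_gt0. Qed.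

Lemma F_condE w s : I01 w -> 0 <= s <= 1 ->
  F_cond f s w = \int[leb]_(x in `[0, s]) f_cond f x w.
Proof.
move=> wI /andP[s0 s1]; rewrite RintegralZr//.
apply: integrableS (integrable_section wI) => //; first exact: measurable_I01.
by move=> x /=; rewrite I01E in_itv /= => /andP[-> /le_trans]; exact.
Qed.

Lemma Rintegral_f_cond w : I01 w -> \int[leb]_(x in I01) f_cond f x w = 1.
Proof.
move=> wI; rewrite RintegralZr//; last 2 first.
- exact: measurable_I01.
- exact: integrable_section.
by rewrite divff// gt_eqF// fW_gt0.
Qed.

Lemma F_cond0 w : I01 w -> F_cond f 0 w = 0.
Proof. by move=> wI; rewrite F_condE ?lexx ?ler01// set_itv1 Rintegral_set1. Qed.

Lemma F_cond1 w : I01 w -> F_cond f 1 w = 1.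
Proof. by move=> wI; rewrite F_condE ?lexx ?ler01//; exact: Rintegral_f_cond. Qed.

(** This is E[k(X) | W = w], written with the conditional density so that the dominance lemmas
    compare densities whose partial integrals are [F_cond]. *)
Definition cexp (k : R -> R) w := \int[leb]_(x in I01) (k x * f_cond f x w).

Lemma integrable_cexp (k : R -> R) (B w : R) : I01 w -> measurable_fun I01 k ->
  (forall x, I01 x -> `|k x| <= B) ->
  leb.-integrable I01 (EFin \o (fun x => k x * f_cond f x w)).
Proof.
move=> wI mk kB; apply: (@integrable_bounded_mul _ _ _ _ _ _ _ _ B) => //.
  exact: measurable_I01.
exact: integrable_f_cond.
Qed.

Lemma Top_cexp (k : R -> R) (B w : R) : I01 w -> measurable_fun I01 k ->
  (forall x, I01 x -> `|k x| <= B) -> Top f k w = cexp k w * fW f w.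
Proof.
move=> wI mk kB; rewrite /cexp -RintegralZr; last 2 first.
- exact: measurable_I01.
- exact: integrable_cexp kB.
apply: eq_Rintegral => x _; rewrite /f_cond -!mulrA mulVf ?mulr1//.
by rewrite gt_eqF// fW_gt0.
Qed.

Definition pos (k : R -> R) x := Num.max (k x) 0.
Definition neg (k : R -> R) x := Num.max (- k x) 0.

Section Monotone.
Variable m : R -> R.
Hypothesis mh : nondecreasing01 m.

Lemma nondecreasing01_pos : nondecreasing01 (pos m).
Proof.
move=> x y xI yI xy; rewrite /pos ge_max !le_max lexx orbT andbT.
by rewrite mh.
Qed.

Lemma nonincreasing01_neg : nonincreasing01 (neg m).
Proof.
move=> x y xI yI xy; rewrite /neg ge_max !le_max lexx orbT andbT.
by rewrite lerN2 mh.
Qed.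

Lemma pos_ge0 x : 0 <= pos m x. Proof. by rewrite le_max lexx orbT. Qed.
Lemma neg_ge0 x : 0 <= neg m x. Proof. by rewrite le_max lexx orbT. Qed.

Lemma I01_0 : I01 0. Proof. by rewrite I01E lexx ler01. Qed.
Lemma I01_1 : I01 1. Proof. by rewrite I01E lexx ler01. Qed.

Lemma pos_bounded x : I01 x -> `|pos m x| <= pos m 1.
Proof.
move=> xI; rewrite ger0_norm ?pos_ge0// nondecreasing01_pos//; first exact: I01_1.
by move: xI; rewrite I01E => /andP[].
Qed.

Lemma neg_bounded x : I01 x -> `|neg m x| <= neg m 0.
Proof.
move=> xI; rewrite ger0_norm ?neg_ge0// nonincreasing01_neg//; first exact: I01_0.
by move: xI; rewrite I01E => /andP[].
Qed.

Lemma pos_subneg x : m x = pos m x - neg m x.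
Proof.
rewrite /pos /neg; have [h|/ltW h] := leP 0 (m x).
  by rewrite max_r ?oppr_le0// subr0.
by rewrite max_l ?oppr_ge0// sub0r opprK.
Qed.

Lemma nondecreasing01_bounded x : I01 x -> `|m x| <= pos m 1 + neg m 0.
Proof.
move=> xI; rewrite [m x]pos_subneg (le_trans (ler_normB _ _))//.
by rewrite lerD ?pos_bounded ?neg_bounded.
Qed.

Lemma integrable_cexp_pos w : I01 w ->
  leb.-integrable I01 (EFin \o (fun x => pos m x * f_cond f x w)).
Proof.
move=> wI; apply: integrable_cexp pos_bounded => //.
by apply: nondecreasing01_measurable; exact: nondecreasing01_pos.
Qed.

Lemma integrable_cexp_neg w : I01 w ->
  leb.-integrable I01 (EFin \o (fun x => neg m x * f_cond f x w)).
Proof.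
move=> wI; apply: integrable_cexp neg_bounded => //.
by apply: nonincreasing01_measurable; exact: nonincreasing01_neg.
Qed.

Lemma cexp_pos_neg w : I01 w -> cexp m w = cexp (pos m) w - cexp (neg m) w.
Proof.
move=> wI; rewrite /cexp -RintegralB; last 3 first.
- exact: measurable_I01.
- exact: integrable_cexp_pos.
- exact: integrable_cexp_neg.
by apply: eq_Rintegral => x _; rewrite -mulrBl -pos_subneg.
Qed.

(** The positive part of [m] is nondecreasing and vanishes left of [y], so only the conditional
    survival functions from [y] on matter. *)
Lemma cexp_pos_dominance u v C y : I01 u -> I01 v -> 0 <= C -> y <= 1 ->
  (forall x, I01 x -> x < y -> m x <= 0) ->
  (forall s, 0 <= s <= 1 -> y <= s ->
    C * (1 - F_cond f s u) <= 1 - F_cond f s v) ->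
  C * cexp (pos m) u <= cexp (pos m) v.
Proof.
move=> uI vI C0 y1 my H; apply: (@dominance_upper _ _ _ C _ _ _ _ C0 _ y) => //.
- exact: integrable_f_cond.
- exact: integrable_f_cond.
- by move=> x; exact: f_cond_ge0.
- by move=> x; exact: f_cond_ge0.
- exact: nondecreasing01_pos.
- by move=> x _; exact: pos_ge0.
- by move=> x xI xy; rewrite /pos max_r// my.
by move=> s s01 ys; rewrite !Rintegral_f_cond// -!F_condE// H.
Qed.

(** The negative part of [m] is nonincreasing and vanishes right of [y], so only the conditional
    distribution functions up to [y] matter. *)
Lemma cexp_neg_dominance u v C y : I01 u -> I01 v -> 0 <= C -> 0 <= y ->
  (forall x, I01 x -> y < x -> 0 <= m x) ->
  (forall s, 0 <= s <= 1 -> s <= y -> C * F_cond f s u <= F_cond f s v) ->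
  C * cexp (neg m) u <= cexp (neg m) v.
Proof.
move=> uI vI C0 y0 my H; apply: (@dominance_lower _ _ _ C _ _ _ _ C0 _ y) => //.
- exact: integrable_f_cond.
- exact: integrable_f_cond.
- by move=> x; exact: f_cond_ge0.
- by move=> x; exact: f_cond_ge0.
- exact: nonincreasing01_neg.
- by move=> x _; exact: neg_ge0.
- by move=> x xI xy; rewrite /neg max_r// oppr_le0 my.
by move=> s s01 ys; rewrite -!F_condE// H.
Qed.

End Monotone.
End ConditionalDensity.

(** * Arithmetic of the gap between the two instrument values *)

(** Here [t] is the factor of [cp] coming from [CF]. Since [4t <= C - 1] and [4t <= 2], the product
    [t(C + 1) = t(C - 1) + 2t] is at most twice [(C - 1)/2]. *)
Lemma gap_constant (R : realType) (C : R) : 1 < C ->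
  let t := Num.min (C - 1) 2 / 4 in
  [/\ 0 < t, t * (C + 1) <= C - 1 & 2 * t <= C - 1].
Proof.
move=> C1 t.
have t1 : 4 * t <= C - 1 by rewrite /t mulrC divfK// ge_min lexx.
have t2 : 4 * t <= 2 by rewrite /t mulrC divfK// ge_min lexx orbT.
have t0 : 0 < t by rewrite divr_gt0// lt_min subr_gt0 C1 ltr0n.
by split => //; nra.
Qed.

(* With [P_i = E[m^+ | w_i]] and [N_i = E[m^- | w_i]], the convex combination
   of [P2 - N2] and [N1 - P1] with weights [C/(C+1)] and [1/(C+1)] cancels
   [N2]. *)
Lemma gap_one_sided (R : realType) (C A P1 P2 N1 N2 : R) : 1 < C -> 0 <= A ->
  P1 <= P2 -> C * N2 <= N1 -> A <= P2 ->
  Num.min (C - 1) 2 / 4 * A <= Num.max (P2 - N2) (N1 - P1).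
Proof.
move=> C1 A0 P12 N12 AP; have [t0 tC _] := gap_constant C1.
rewrite leNgt gt_max; apply/negP => /andP[h1 h2].
by move: t0 tC h1 h2; set t := _ / 4; nra.
Qed.

(** The two entries of the maximum add up to at least [(C - 1)(P1 + N2)], and the maximum is at
    least half the sum. *)
Lemma gap_two_sided (R : realType) (C A P1 P2 N1 N2 : R) : 1 < C -> 0 <= A ->
  C * P1 <= P2 -> C * N2 <= N1 -> A <= P1 + N2 ->
  Num.min (C - 1) 2 / 4 * A <= Num.max (P2 - N2) (N1 - P1).
Proof.
move=> C1 A0 P12 N12 AP; have [t0 _ tC] := gap_constant C1.
rewrite leNgt gt_max; apply/negP => /andP[h1 h2].
by move: t0 tC h1 h2; set t := _ / 4; nra.
Qed.

(** * Lower bound on T m for nondecreasing m *)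

Section KeyInequality.
Context {R : realType}.
Notation leb := (@lebesgue_measure R).
Notation I01 := (@I01 R).
Variables (f : R -> R -> R) (x1 tx1 tx2 x2 w1 w2 CF cf cW CW : R).
Hypotheses (x1_ge0 : 0 <= x1) (x1_tx1 : x1 < tx1) (tx12 : tx1 < tx2)
  (tx2_x2 : tx2 < x2) (x2_le1 : x2 <= 1)
  (w1_gt0 : 0 < w1) (w12 : w1 < w2) (w2_lt1 : w2 < 1).
Hypotheses (mf : measurable_fun setT (fun p : R * R => f p.1 p.2))
  (f0 : forall x w, I01 x -> I01 w -> 0 <= f x w)
  (cW0 : 0 < cW) (fWb : forall w, I01 w -> cW <= fW f w <= CW).
Hypotheses (mono_iv : Assumption1 f x1 x2 w1 w2 CF) (cf0 : 0 < cf)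
  (f_cond_ge : forall x w, x1 <= x <= x2 -> (w = w1 \/ w = w2) ->
     cf <= f_cond f x w).

Lemma measurable_Top (h : R -> R) : measurable_fun I01 h -> measurable_fun setT (Top f h).
Proof.
move=> mh; have mI : measurable I01 := measurable_I01.
have mh' : measurable_fun setT (h \_ I01) by exact: (measurable_restrictT h mI).1 mh.
pose G (z : R * R) := ((h \_ I01) z.1 * f z.1 z.2)%:E.
have mG : measurable_fun setT G.
  apply/measurable_EFinP; apply: measurable_funM => //.
  exact: (measurableT_comp mh').
(* The integral of a signed function is the difference of those of its positive and negative parts;
   Tonelli makes each measurable in [w]. *)
have -> : Top f h = fine \o
    (fun w => \int[leb]_x (G^\+ (x, w)) - \int[leb]_x (G^\- (x, w)))%E.
  apply/funext => w; rewrite /Top /=; congr fine.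
  rewrite integral_mkcond [LHS]integralE; congr (_ - _)%E;
    apply: eq_integral => x _; rewrite ?funeposE ?funenegE /G /= !patchE;
    by case: ifP => //; rewrite mul0r.
apply: measurableT_comp; first exact: fine_measurable.
apply: emeasurable_funB.
- have := @measurable_fun_fubini_tonelli_G _ _ (measurableTypeR R)
    (measurableTypeR R) R leb (G^\+)%E.
  by apply => //; exact: measurable_funepos mG.
- have := @measurable_fun_fubini_tonelli_G _ _ (measurableTypeR R)
    (measurableTypeR R) R leb (G^\-)%E.
  by apply => //; exact: measurable_funeneg mG.
Qed.

Lemma I01_w w : 0 < w < 1 -> I01 w.
Proof. by rewrite I01E => /andP[/ltW -> /ltW ->]. Qed.

Let w1I : I01 w1. Proof. by apply: I01_w; rewrite w1_gt0 (lt_trans w12). Qed.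
Let w2I : I01 w2. Proof. by apply: I01_w; rewrite w2_lt1 (lt_trans w1_gt0). Qed.
Let CF1 : 1 < CF. Proof. by case: mono_iv => _ []. Qed.
Let CF0 : 0 <= CF. Proof. by rewrite ltW// (lt_trans ltr01). Qed.

(** The assumption covers [s] strictly between 0 and 1; at the endpoints every conditional
    distribution function is 0 or 1. The next two lemmas extend the other comparisons to an endpoint
    likewise. *)
Lemma F_cond_decreasing u v s : 0 < u < 1 -> 0 < v < 1 -> u <= v ->
  0 <= s <= 1 -> F_cond f s v <= F_cond f s u.
Proof.
move=> u01 v01 uv /andP[]; rewrite le_eqVlt => /predU1P[<- _|s0].
  by rewrite !(F_cond0 mf f0 cW0 fWb)//; exact: I01_w.
rewrite le_eqVlt => /predU1P[->|s1].
  by rewrite !(F_cond1 mf f0 cW0 fWb)//; exact: I01_w.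
by case: mono_iv => H _; apply: H => //; rewrite s0 s1.
Qed.

Lemma F_cond_low s : 0 <= s <= 1 -> s < x2 -> CF * F_cond f s w2 <= F_cond f s w1.
Proof.
move=> /andP[]; rewrite le_eqVlt => /predU1P[<- _ _|s0 s1 sx].
  by rewrite !(F_cond0 mf f0 cW0 fWb)// mulr0.
by case: mono_iv => _ [_ [H _]]; apply: H; rewrite s0.
Qed.

Lemma F_cond_up s : 0 <= s <= 1 -> x1 < s ->
  CF * (1 - F_cond f s w1) <= 1 - F_cond f s w2.
Proof.
move=> /andP[s0]; rewrite le_eqVlt => /predU1P[-> _|s1 sx].
  by rewrite !(F_cond1 mf f0 cW0 fWb)// subrr mulr0.
by case: mono_iv => _ [_ [_ H]]; apply: H; rewrite sx.
Qed.

Let x1_tx2 : x1 < tx2. Proof. exact: lt_trans tx12. Qed.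
Let tx1_x2 : tx1 < x2. Proof. exact: lt_trans tx2_x2. Qed.

Lemma itv_sub_I01 (a b : R) : 0 <= a -> b <= 1 -> `[a, b] `<=` I01.
Proof.
move=> a0 b1 x /=; rewrite I01E in_itv /= => /andP[ax xb].
by rewrite (le_trans a0)//= (le_trans xb).
Qed.

Let itvI : `[x1, x2] `<=` I01. Proof. exact: itv_sub_I01. Qed.
Let tx1I : I01 tx1.
Proof. by apply: itvI; rewrite /= in_itv /= !ltW. Qed.
Let tx2I : I01 tx2.
Proof. by apply: itvI; rewrite /= in_itv /= !ltW. Qed.

Section Monotone.
Variable m : R -> R.
Hypothesis mh : nondecreasing01 m.

Lemma cexp_pos_le u v : 0 < u < 1 -> 0 < v < 1 -> u <= v ->
  cexp f (pos m) u <= cexp f (pos m) v.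
Proof.
move=> u01 v01 uv; rewrite -[X in X <= _]mul1r.
(* With [y := 0] the sign condition is vacuous, which leaves plain first-order stochastic
   dominance. *)
apply: (cexp_pos_dominance mf f0 cW0 fWb mh (y := 0)) => //.
- exact: I01_w.
- exact: I01_w.
- by move=> x; rewrite I01E => /andP[x0 _]; rewrite ltNge x0.
by move=> s s01 _; rewrite mul1r lerB// F_cond_decreasing.
Qed.

Lemma cexp_neg_ge u v : 0 < u < 1 -> 0 < v < 1 -> u <= v ->
  cexp f (neg m) v <= cexp f (neg m) u.
Proof.
move=> u01 v01 uv; rewrite -[X in X <= _]mul1r.
apply: (cexp_neg_dominance mf f0 cW0 fWb mh (y := 1)) => //.
- exact: I01_w.
- exact: I01_w.
- by move=> x; rewrite I01E => /andP[_ x0]; rewrite ltNge x0.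
by move=> s s01 _; rewrite mul1r F_cond_decreasing.
Qed.

Lemma cexp_nondecreasing u v : 0 < u < 1 -> 0 < v < 1 -> u <= v ->
  cexp f m u <= cexp f m v.
Proof.
move=> u01 v01 uv; rewrite !(cexp_pos_neg mf f0 cW0 fWb mh); [|exact: I01_w..].
by rewrite lerB ?cexp_pos_le ?cexp_neg_ge.
Qed.

Let delta : R := Num.min (tx1 - x1) (x2 - tx2).
Let delta0 : 0 < delta. Proof. by rewrite lt_min !subr_gt0 x1_tx1. Qed.

(** On [[tx2, x2]] the conditional density is at least [cf] and the positive part at least its value
    at [tx2]; the length is at least [delta]. *)
Lemma cexp_pos_ge_cst w : (w = w1 \/ w = w2) ->
  cf * delta * pos m tx2 <= cexp f (pos m) w.
Proof.
move=> ww; have wI : I01 w by case: ww => ->.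
have sI : `[tx2, x2] `<=` I01.
  by apply: itv_sub_I01 => //; rewrite (le_trans x1_ge0)// ltW.
have lty : (leb `[tx2, x2] < +oo)%E.
  by rewrite lebesgue_measure_itv /= lte_fin tx2_x2 /= ltry.
apply: (@le_trans _ _ (cf * pos m tx2 * fine (leb `[tx2, x2]))).
  rewrite lebesgue_measure_itv /= lte_fin tx2_x2 /= mulrAC ler_wpM2l//.
    by rewrite mulr_ge0 ?pos_ge0// ltW.
  by rewrite ge_min lexx orbT.
apply: Rintegral_ge_cst => //.
- exact: measurable_I01.
- exact: (integrable_cexp_pos mf f0 cW0 fWb mh).
- move=> x xI; rewrite mulr_ge0 ?pos_ge0//.
  exact: (f_cond_ge0 f0 cW0 fWb).
move=> x xin; have xI := sI _ xin.
move: xin; rewrite /= in_itv /= => /andP[a b].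
rewrite mulrC ler_pM ?pos_ge0 ?(ltW cf0)//.
  exact: nondecreasing01_pos.
by apply: f_cond_ge => //; rewrite b andbT (le_trans (ltW x1_tx2)).
Qed.

(** The same estimate for the negative part, on [[x1, tx1]]. *)
Lemma cexp_neg_ge_cst w : (w = w1 \/ w = w2) ->
  cf * delta * neg m tx1 <= cexp f (neg m) w.
Proof.
move=> ww; have wI : I01 w by case: ww => ->.
have sI : `[x1, tx1] `<=` I01.
  by apply: itv_sub_I01 => //; rewrite (le_trans (ltW tx1_x2)).
have lty : (leb `[x1, tx1] < +oo)%E.
  by rewrite lebesgue_measure_itv /= lte_fin x1_tx1 /= ltry.
apply: (@le_trans _ _ (cf * neg m tx1 * fine (leb `[x1, tx1]))).
  rewrite lebesgue_measure_itv /= lte_fin x1_tx1 /= mulrAC ler_wpM2l//.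
    by rewrite mulr_ge0 ?neg_ge0// ltW.
  by rewrite ge_min lexx.
apply: Rintegral_ge_cst => //.
- exact: measurable_I01.
- exact: (integrable_cexp_neg mf f0 cW0 fWb mh).
- move=> x xI; rewrite mulr_ge0 ?neg_ge0//.
  exact: (f_cond_ge0 f0 cW0 fWb).
move=> x xin; have xI := sI _ xin.
move: xin; rewrite /= in_itv /= => /andP[a b].
rewrite mulrC ler_pM ?neg_ge0 ?(ltW cf0)//.
  exact: nonincreasing01_neg.
by apply: f_cond_ge => //; rewrite a /= (le_trans b (ltW tx1_x2)).
Qed.

Lemma cexp_gap :
  Num.min (CF - 1) 2 / 4 * (cf * delta * (pos m tx2 + neg m tx1)) <=
  Num.max (cexp f m w2) (- cexp f m w1).
Proof.
rewrite !(cexp_pos_neg mf f0 cW0 fWb mh)// opprB.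
have cd0 : 0 <= cf * delta by rewrite mulr_ge0 ?ltW.
have A0 : 0 <= cf * delta * (pos m tx2 + neg m tx1).
  by rewrite mulr_ge0// addr_ge0 ?pos_ge0 ?neg_ge0.
have w1i : 0 < w1 < 1 by rewrite w1_gt0 (lt_trans w12).
have w2i : 0 < w2 < 1 by rewrite w2_lt1 (lt_trans w1_gt0).
have ww := ltW w12.
have posD y : I01 y -> x1 < y -> m y <= 0 ->
    CF * cexp f (pos m) w1 <= cexp f (pos m) w2.
  move=> yI yx my; apply: (cexp_pos_dominance mf f0 cW0 fWb mh (y := y)) => //.
  - by move: yI; rewrite I01E => /andP[].
  - by move=> x xI /ltW xy; rewrite (le_trans _ my)// mh.
  by move=> s s01 ys; apply: F_cond_up => //; exact: lt_le_trans ys.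
have negD y : I01 y -> y < x2 -> 0 <= m y ->
    CF * cexp f (neg m) w2 <= cexp f (neg m) w1.
  move=> yI yx my; apply: (cexp_neg_dominance mf f0 cW0 fWb mh (y := y)) => //.
  - by move: yI; rewrite I01E => /andP[].
  - by move=> x xI /ltW xy; rewrite (le_trans my)// mh.
  by move=> s s01 ys; apply: F_cond_low => //; exact: le_lt_trans yx.
(* Nonnegative already at [tx1]: the negative part shrinks by the factor [CF], the positive part is
   merely monotone, and [neg m tx1] is 0. *)
have [m1|m1] := leP 0 (m tx1).
  apply: (gap_one_sided CF1 A0); first exact: cexp_pos_le.
    by apply: (negD tx1).
  rewrite /neg max_r ?oppr_le0// addr0.
  by apply: cexp_pos_ge_cst; right.
(* Nonpositive still at [tx2]: the same argument with positive and negative parts, and [w1] and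
   [w2], exchanged. *)
have [m2|m2] := leP (m tx2) 0.
  rewrite maxC; apply: (gap_one_sided CF1 A0); first exact: cexp_neg_ge.
    by apply: (posD tx2).
  rewrite /pos max_r// add0r.
  by apply: cexp_neg_ge_cst; left.
(* A sign change between [tx1] and [tx2] gives both factors at once. *)
apply: (gap_two_sided CF1 A0).
- by apply: (posD tx1) => //; exact: ltW.
- by apply: (negD tx2) => //; exact: ltW.
by rewrite mulrDr lerD ?cexp_pos_ge_cst ?cexp_neg_ge_cst//; [left|right].
Qed.

Lemma Top_bounded w : I01 w -> `|Top f m w| <= (pos m 1 + neg m 0) * CW.
Proof.
move=> wI; have B0 : 0 <= pos m 1 + neg m 0 by rewrite addr_ge0 ?pos_ge0 ?neg_ge0.
have mI := measurable_I01 (R := R).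
have imf : leb.-integrable I01 (EFin \o (fun x => m x * f x w)).
  apply: (@integrable_bounded_mul _ _ _ _ _ _ _ _ (pos m 1 + neg m 0)) => //.
  - exact: nondecreasing01_measurable.
  - exact: nondecreasing01_bounded.
  exact: (integrable_section mf f0 cW0 fWb).
have ibf : leb.-integrable I01 (EFin \o (fun x => (pos m 1 + neg m 0) * f x w)).
  apply: (@integrable_bounded_mul _ _ _ _ _ _ _ _ (pos m 1 + neg m 0)) => //.
    by move=> x _; rewrite ger0_norm.
  exact: (integrable_section mf f0 cW0 fWb).
have [_ fWC] := andP (fWb wI).
apply: le_trans (ler_wpM2l B0 fWC).
rewrite /Top /fW -/(Rintegral leb _ _) -RintegralZl//; last first.
  exact: (integrable_section mf f0 cW0 fWb).
apply: (le_trans (le_normr_Rintegral _ imf)) => //.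
apply: le_Rintegral => //.
  by have := integrable_norm imf.
move=> x xI; rewrite normrM (ger0_norm (f0 xI wI)) ler_wpM2r ?f0//.
exact: nondecreasing01_bounded.
Qed.

(** [L2norm] passes through [fine], so finiteness has to be known before a lower bound on the
    integral bounds the norm. *)
Lemma integrable_Top_sqr :
  leb.-integrable I01 (EFin \o (fun w => (Top f m w) ^+ 2)).
Proof.
have mI := measurable_I01 (R := R).
have i1 : leb.-integrable I01 (EFin \o cst (1 : R)).
  apply/integrableP; split; first exact/measurable_EFinP.
  under eq_integral do rewrite /= normr1.
  by rewrite integral_cst//= mul1e lebesgue_measure_itv /= lte_fin ltr01 /= ltry.
have := @integrable_bounded_mul _ _ _ leb I01 mI (fun w => (Top f m w) ^+ 2)
  (cst 1) (((pos m 1 + neg m 0) * CW) ^+ 2).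
have -> : (fun w => (Top f m w) ^+ 2 * cst 1 w) = (fun w => (Top f m w) ^+ 2).
  by apply/funext => w; rewrite mulr1.
apply => //.
- apply: measurable_funX; apply: measurable_funTS; apply: measurable_Top.
  exact: nondecreasing01_measurable.
- move=> w wI; rewrite normrX lerXn2r ?nnegrE//.
    by rewrite (le_trans _ (Top_bounded wI)).
  exact: Top_bounded.
Qed.

(** Integrating [c ^+ 2] over [A] gives [c] times the root of the measure of [A]; a measure at most
    1 is below its own root. *)
Lemma L2norm_ge (A : set R) (c : R) : measurable A -> A `<=` I01 ->
  (leb A < +oo)%E -> fine (leb A) <= 1 -> 0 <= c ->
  (forall w, A w -> c <= `|Top f m w|) ->
  c * fine (leb A) <= L2norm (Top f m).
Proof.
move=> mA AI lty l1 c0 cT.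
have l0 : 0 <= fine (leb A) by rewrite fine_ge0.
rewrite -[X in X <= _](ger0_norm (mulr_ge0 c0 l0)) -sqrtr_sqr.
rewrite /L2norm ler_wsqrtr// exprMn; apply: (@le_trans _ _ (c ^+ 2 * fine (leb A))).
  by rewrite ler_wpM2l ?sqr_ge0// expr2 ler_piMr.
apply: Rintegral_ge_cst => //.
- exact: measurable_I01.
- exact: integrable_Top_sqr.
- by move=> w _; exact: sqr_ge0.
by move=> w Aw; rewrite -(real_normK (num_real (Top f m w))) lerXn2r ?nnegrE ?cT.
Qed.

(** The larger of the two entries is nonnegative. Monotonicity of the conditional expectation
    spreads it over [w >= w2] or [w <= w1], and [fW >= cW] turns it into a bound on [Top f m]. *)
Lemma L2norm_Top_ge :
  cW * Num.min (1 - w2) w1 * Num.max (cexp f m w2) (- cexp f m w1) <=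
  L2norm (Top f m).
Proof.
have D0 : 0 <= Num.max (cexp f m w2) (- cexp f m w1).
  apply: le_trans cexp_gap; have [t0 _ _] := gap_constant CF1.
  rewrite mulr_ge0 ?(ltW t0)// mulr_ge0 ?addr_ge0 ?pos_ge0 ?neg_ge0//.
  by rewrite mulr_ge0 ?ltW.
have w1i : 0 < w1 < 1 by rewrite w1_gt0 (lt_trans w12).
have w2i : 0 < w2 < 1 by rewrite w2_lt1 (lt_trans w1_gt0).
have TE w : I01 w -> Top f m w = cexp f m w * fW f w.
  move=> wI; apply: (Top_cexp mf f0 cW0 fWb wI).
    exact: nondecreasing01_measurable.
  exact: nondecreasing01_bounded.
move: D0; have [M21|M12] := leP (- cexp f m w1) (cexp f m w2) => D0.
  (* The endpoint 1 is excluded, and 0 in the other case, because monotonicity in [w] is available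
     on the open interval. *)
  have lE : leb `[w2, 1[ = (1 - w2)%:E.
    by rewrite lebesgue_measure_itv /= lte_fin w2_lt1.
  apply: (@le_trans _ _ (cW * cexp f m w2 * fine (leb `[w2, 1[))).
    rewrite lE /= mulrAC ler_wpM2l ?ge_min ?lexx//.
    by rewrite mulr_ge0// ltW.
  have sI w : [set` `[w2, 1[] w -> 0 < w < 1.
    by rewrite /= in_itv /= => /andP[a ->]; rewrite (lt_le_trans _ a)// (lt_trans w1_gt0).
  apply: L2norm_ge => //.
  - by move=> w /sI/I01_w.
  - by rewrite lE ltry.
  - by rewrite lE /= gerBl ltW// (lt_trans w1_gt0).
  - by rewrite mulr_ge0// ltW.
  move=> w Aw; have w01 := sI _ Aw; have wI := I01_w w01.
  rewrite TE//; apply: le_trans (ler_norm _).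
  rewrite mulrC; apply: ler_pM; [exact: D0|exact: ltW| |by have [] := andP (fWb wI)].
  by apply: cexp_nondecreasing => //; move: Aw; rewrite /= in_itv /= => /andP[].
have lE : leb `]0, w1] = w1%:E.
  by rewrite lebesgue_measure_itv /= lte_fin w1_gt0 oppr0 adde0.
apply: (@le_trans _ _ (cW * (- cexp f m w1) * fine (leb `]0, w1]))).
  rewrite lE /= mulrAC ler_wpM2l ?ge_min ?lexx ?orbT//.
  by rewrite mulr_ge0// ltW.
have sI w : [set` `]0, w1]] w -> 0 < w < 1.
  rewrite /= in_itv /= => /andP[-> a]; rewrite (le_lt_trans a)//.
  by rewrite (lt_trans w12).
apply: L2norm_ge => //.
- by move=> w /sI/I01_w.
- by rewrite lE ltry.
- by rewrite lE /= ltW// (lt_trans w12).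
- by rewrite mulr_ge0// ltW.
move=> w Aw; have w01 := sI _ Aw; have wI := I01_w w01.
rewrite TE// -normrN -mulNr; apply: le_trans (ler_norm _).
rewrite mulrC; apply: ler_pM; [exact: D0|exact: ltW| |by have [] := andP (fWb wI)].
by rewrite lerN2 cexp_nondecreasing//; move: Aw; rewrite /= in_itv /= => /andP[].
Qed.

Let C1 := Num.sqrt (tx2 - tx1) / delta.
Let cp := Num.min (1 - w2) w1 * Num.min (CF - 1) 2 * cW * cf / 4.

(** The witness is [pos m tx2 + neg m tx1], which dominates [m] in absolute value on [[tx1, tx2]] by
    monotonicity. Times the root of the length it bounds the truncated norm of [m]. *)
Lemma truncated_bound_nondecreasing : exists K, [/\ 0 <= K,
  forall x, tx1 <= x <= tx2 -> `|m x| <= K &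
  Num.sqrt (tx2 - tx1) * K <= C1 / cp * L2norm (Top f m)].
Proof.
exists (pos m tx2 + neg m tx1); split.
- by rewrite addr_ge0 ?pos_ge0 ?neg_ge0.
- move=> x /andP[a b]; have xI : I01 x.
    apply: itvI; rewrite /= in_itv /= (le_trans (ltW x1_tx1) a).
    by rewrite (le_trans b (ltW tx2_x2)).
  rewrite [m x]pos_subneg (le_trans (ler_normB _ _))//.
  rewrite !ger0_norm ?pos_ge0 ?neg_ge0//.
  by apply: lerD; [exact: nondecreasing01_pos | exact: nonincreasing01_neg].
have cp0 : 0 < cp.
  rewrite divr_gt0// !mulr_gt0// lt_min ?subr_gt0 ?w2_lt1 ?CF1 ?ltr0n//.
have H : cp * (delta * (pos m tx2 + neg m tx1)) <= L2norm (Top f m).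
  apply: le_trans L2norm_Top_ge.
  have mw0 : 0 <= cW * Num.min (1 - w2) w1.
    by rewrite mulr_ge0 ?(ltW cW0)// le_min subr_ge0 !ltW.
  apply: le_trans (ler_wpM2l mw0 cexp_gap).
  by rewrite le_eqVlt; apply/orP; left; apply/eqP; rewrite /cp; field.
apply: (@le_trans _ _ (C1 / cp * (cp * (delta * (pos m tx2 + neg m tx1))))).
  rewrite mulrA divfK ?gt_eqF// mulrA divfK// gt_eqF//.
by rewrite ler_wpM2l// divr_ge0 ?(ltW cp0)// divr_ge0 ?sqrtr_ge0// ltW.
Qed.

End Monotone.
End KeyInequality.

(** * Almost-everywhere arguments and L2 norms *)

Lemma ae_imply (d : measure_display) (T : measurableType d) (R : realType)
    (mu : {measure set T -> \bar R}) (P Q : T -> Prop) :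
  {ae mu, forall x, P x} -> (forall x, P x -> Q x) -> {ae mu, forall x, Q x}.
Proof. by move=> aeP PQ; apply: filterS aeP. Qed.

Lemma ae_imply2 (d : measure_display) (T : measurableType d) (R : realType)
    (mu : {measure set T -> \bar R}) (P Q S : T -> Prop) :
  {ae mu, forall x, P x} -> {ae mu, forall x, Q x} ->
  (forall x, P x -> Q x -> S x) -> {ae mu, forall x, S x}.
Proof. by move=> aeP aeQ PQS; apply: filterS2 aeP aeQ. Qed.

Section Identification.
Context {R : realType}.
Notation leb := (@lebesgue_measure R).
Notation I01 := (@I01 R).

(** Square integrability of [f] puts almost every section [f^~ w] in L2, and then [h * f] is
    dominated by the sum of the two squares. *)
Lemma ae_integrable_product (f : R -> R -> R) (h : R -> R) (CT : R) :
  measurable_fun setT (fun p : R * R => f p.1 p.2) -> inL2 h ->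
  (\int[leb]_(w in I01) (\int[leb]_(x in I01) ((f x w) ^+ 2)%:E) <= CT%:E)%E ->
  {ae leb, forall w, I01 w ->
    leb.-integrable I01 (EFin \o (fun x => h x * f x w))}.
Proof.
move=> mf [mh hfin] fCT.
have mI := measurable_I01 (R := R).
pose S w := (\int[leb]_(x in I01) ((f x w) ^+ 2)%:E)%E.
have m1 : measurable_fun setT ((fun=> 1 : R) \_ I01).
  exact: (measurable_restrictT _ mI).1.
pose G (z : R * R) := (((fun=> 1 : R) \_ I01) z.1 * (f z.1 z.2) ^+ 2)%:E.
have mG : measurable_fun setT G.
  apply/measurable_EFinP; apply: measurable_funM.
    exact: (measurableT_comp m1).
  exact: measurable_funX.
have mS : measurable_fun setT S.
  have -> : S = (fun w => \int[leb]_x (G (x, w)))%E.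
    apply/funext => w; rewrite /S integral_mkcond.
    apply: eq_integral => x _; rewrite /G /= !patchE.
    by case: ifP; rewrite ?mul1r ?mul0r.
  have G0 z : (0 <= G z)%E.
    by rewrite lee_fin /G patchE; case: ifP; rewrite ?mul1r ?mul0r ?sqr_ge0.
  exact: (@measurable_fun_fubini_tonelli_G _ _ (measurableTypeR R)
    (measurableTypeR R) R leb G mG G0).
have iS : leb.-integrable I01 S.
  apply/integrableP; split; first exact: measurable_funTS.
  apply: le_lt_trans (ltry CT); apply: le_trans fCT.
  rewrite le_eqVlt; apply/orP; left; apply/eqP; apply: eq_integral => w _.
  by rewrite gee0_abs//; apply: integral_ge0 => x _; rewrite lee_fin sqr_ge0.
have := @integrable_ae _ _ _ leb I01 mI S iS.
apply: filterS => w /[apply] Sfin.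
have mw : measurable_fun I01 (f^~ w).
  by apply: measurable_funTS; exact: measurable_section mf w.
apply/integrableP; split.
  by apply/measurable_EFinP; exact: measurable_funM.
apply: (@le_lt_trans _ _
  (\int[leb]_(x in I01) (((h x) ^+ 2)%:E + ((f x w) ^+ 2)%:E))%E).
  apply: ge0_le_integral => //.
  - by apply: measurableT_comp => //; apply/measurable_EFinP; exact: measurable_funM.
  - apply: emeasurable_funD; apply/measurable_EFinP; exact: measurable_funX.
  move=> x _; rewrite /= -EFinD lee_fin ler_norml; apply/andP; split; nra.
rewrite ge0_integralD//.
- by rewrite lte_add_pinfty// ltey_eq Sfin.
- by move=> x _; rewrite lee_fin sqr_ge0.
- by apply/measurable_EFinP; exact: measurable_funX.
- by move=> x _; rewrite lee_fin sqr_ge0.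
- by apply/measurable_EFinP; exact: measurable_funX.
Qed.

Lemma L2norm_ae_eq (u v : R -> R) :
  measurable_fun I01 u -> measurable_fun I01 v ->
  {ae leb, forall w, I01 w -> u w = v w} -> L2norm u = L2norm v.
Proof.
move=> mu mv uv; rewrite /L2norm; congr (Num.sqrt (fine _)).
apply: ae_eq_integral.
- exact: measurable_I01.
- by apply/measurable_EFinP; exact: measurable_funX.
- by apply/measurable_EFinP; exact: measurable_funX.
by apply: (ae_imply uv) => w H wI; rewrite /= H.
Qed.

Lemma L2normZ (c : R) (u : R -> R) : measurable_fun I01 u -> 0 <= c ->
  L2norm (fun x => c * u x) = c * L2norm u.
Proof.
move=> mu c0; rewrite /L2norm.
under eq_integral do rewrite exprMn EFinM.
rewrite ge0_integralZl//.
- have : (0 <= \int[leb]_(x in I01) ((u x) ^+ 2)%:E)%E.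
    by apply: integral_ge0 => x _; rewrite lee_fin sqr_ge0.
  case: (\int[leb]_(x in I01) _)%E => [r| |] //= r0.
    by rewrite sqrtrM ?sqr_ge0// sqrtr_sqr ger0_norm.
  (* Infinite integral: [fine] sends it to 0, and also its multiple by [c ^+ 2] when [c] is
     nonzero. *)
  have [->|cn0] := eqVneq c 0; first by rewrite expr0n mul0e /= sqrtr0 mul0r.
  by rewrite gt0_muley /= ?sqrtr0 ?mulr0// lte_fin exprn_even_gt0.
- exact: measurable_I01.
- by apply/measurable_EFinP; exact: measurable_funX.
- by move=> x _; rewrite lee_fin sqr_ge0.
- by rewrite lee_fin sqr_ge0.
Qed.

Lemma Top_ae_eq (f : R -> R -> R) (u v : R -> R) w :
  measurable_fun setT (fun p : R * R => f p.1 p.2) ->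
  measurable_fun I01 u -> measurable_fun I01 v ->
  {ae leb, forall x, I01 x -> u x = v x} -> Top f u w = Top f v w.
Proof.
move=> mf mu mv uv; rewrite /Top; congr fine.
have mw : measurable_fun I01 (f^~ w).
  by apply: measurable_funTS; exact: measurable_section mf w.
apply: ae_eq_integral.
- exact: measurable_I01.
- by apply/measurable_EFinP; exact: measurable_funM.
- by apply/measurable_EFinP; exact: measurable_funM.
by apply: (ae_imply uv) => x H xI; rewrite /= H.
Qed.

Lemma L2norm_eq0 (h : R -> R) : inL2 h -> L2norm h = 0 ->
  {ae leb, forall x, I01 x -> h x = 0}.
Proof.
move=> [mh hfin] /eqP; rewrite sqrtr_eq0 => h0.
have mI := measurable_I01 (R := R).
have i0 : (\int[leb]_(x in I01) ((h x) ^+ 2)%:E = 0)%E.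
  have ge : (0 <= \int[leb]_(x in I01) ((h x) ^+ 2)%:E)%E.
    by apply: integral_ge0 => x _; rewrite lee_fin sqr_ge0.
  rewrite -[LHS]fineK ?ge0_fin_numE//; congr EFin.
  by apply/eqP; rewrite eq_le h0 fine_ge0.
have mh2 : measurable_fun I01 (fun x => ((h x) ^+ 2)%:E).
  by apply/measurable_EFinP; exact: measurable_funX.
have := (@ae_eq_integral_abs _ _ _ leb I01 mI _ mh2).1.
under eq_integral do rewrite gee0_abs ?lee_fin ?sqr_ge0//.
move=> /(_ i0); apply: filterS => x /[apply] /= [[/eqP]].
by rewrite sqrf_eq0 => /eqP.
Qed.

(* Integrates [(m - h)^2 <= (1 + s/t) m^2 + (1 + t/s) h^2] with [s] and [t]
   slightly above the norm of [h] and the bound [c]. *)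
Lemma L2norm_on_triangle (a b K c : R) (g m h : R -> R) : a < b ->
  measurable_fun `[a, b] g -> measurable_fun `[a, b] h ->
  (\int[leb]_(x in `[a, b]) ((h x) ^+ 2)%:E < +oo)%E ->
  0 <= K -> (forall x, a <= x <= b -> `|m x| <= K) ->
  {ae leb, forall x, `[a, b]%classic x -> g x + h x = m x} ->
  Num.sqrt (b - a) * K <= c ->
  L2norm_on a b g <= L2norm_on a b h + c.
Proof.
move=> ab mg mh hfin K0 mK gm Kc.
have mI : measurable `[a, b]%classic by exact: measurable_itv.
apply/ler_addgt0Pr => e e0.
pose nh := L2norm_on a b h.
have nh0 : 0 <= nh by exact: sqrtr_ge0.
pose s := nh + e / 2; pose t := c + e / 2.
have c0 : 0 <= c by rewrite (le_trans _ Kc)// mulr_ge0// sqrtr_ge0.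
have s0 : 0 < s by rewrite /s; lra.
have t0 : 0 < t by rewrite /t; lra.
have -> : nh + c + e = s + t by rewrite /s /t; lra.
have st0 : 0 <= s + t by rewrite addr_ge0 ?ltW.
have hs : (\int[leb]_(x in `[a, b]) ((h x) ^+ 2)%:E <= (s ^+ 2)%:E)%E.
  have h0 : (0 <= \int[leb]_(x in `[a, b]) ((h x) ^+ 2)%:E)%E.
    by apply: integral_ge0 => x _; rewrite lee_fin sqr_ge0.
  rewrite -[X in (X <= _)%E]fineK ?ge0_fin_numE// lee_fin.
  rewrite -[X in X <= _]sqr_sqrtr ?fine_ge0// lerXn2r ?nnegrE ?sqrtr_ge0 ?(ltW s0)//.
  by rewrite -/(L2norm_on a b h) -/nh /s; lra.
pose B := (1 + s / t) * K ^+ 2.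
have B0 : 0 <= B by rewrite mulr_ge0 ?sqr_ge0// addr_ge0// divr_ge0// ltW.
have A0 : 0 <= 1 + t / s by rewrite addr_ge0// divr_ge0// ltW.
have H : (\int[leb]_(x in `[a, b]) ((g x) ^+ 2)%:E <= ((s + t) ^+ 2)%:E)%E.
  apply: (@le_trans _ _ (\int[leb]_(x in `[a, b])
     (B%:E + (1 + t / s)%:E * ((h x) ^+ 2)%:E))%E).
    apply: ae_ge0_le_integral => //.
    - by move=> x _; rewrite lee_fin sqr_ge0.
    - by apply/measurable_EFinP; exact: measurable_funX.
    - by move=> x _; rewrite -EFinM -EFinD lee_fin addr_ge0// mulr_ge0 ?sqr_ge0.
    - apply: emeasurable_funD; apply/measurable_EFinP => //.
      by apply: measurable_funM => //; exact: measurable_funX.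
    apply: (ae_imply gm) => x H xI; have {}H := H xI.
    have mx : `|m x| <= K by apply: mK; move: xI; rewrite /= in_itv.
    rewrite -EFinM -EFinD lee_fin /B.
    have mK2 : (m x) ^+ 2 <= K ^+ 2.
      by rewrite -(real_normK (num_real (m x))) lerXn2r ?nnegrE.
    apply: (@le_trans _ _ ((1 + s / t) * (m x) ^+ 2 + (1 + t / s) * (h x) ^+ 2)).
      have -> : g x = m x - h x by rewrite -H addrK.
      rewrite -subr_ge0.
      (* The weights are reciprocal, so the difference is a perfect square over [s * t]. *)
      have -> : (1 + s / t) * m x ^+ 2 + (1 + t / s) * h x ^+ 2 - (m x - h x) ^+ 2
         = (s * m x + t * h x) ^+ 2 / (s * t).
        by field; rewrite !gt_eqF.
      by rewrite divr_ge0 ?sqr_ge0// mulr_ge0 ?ltW.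
    by rewrite lerD2r ler_wpM2l// addr_ge0// divr_ge0// ltW.
  rewrite ge0_integralD//; last 2 first.
  - by move=> x _; rewrite -EFinM lee_fin mulr_ge0 ?sqr_ge0.
  - apply/measurable_EFinP => //.
    by apply: measurable_funM => //; exact: measurable_funX.
  rewrite integral_cst// ge0_integralZl//; last 2 first.
  - by apply/measurable_EFinP; exact: measurable_funX.
  - by move=> x _; rewrite lee_fin sqr_ge0.
  have lE : leb `[a, b] = (b - a)%:E by rewrite lebesgue_measure_itv /= lte_fin ab.
  rewrite /= lE.
  have A0' : (0 <= (1 + t / s)%:E)%E by rewrite lee_fin.
  apply: le_trans (leeD2l _ (lee_wpmul2l A0' hs)) _.
  rewrite -!EFinM -EFinD lee_fin.
  have Kt : K ^+ 2 * (b - a) <= t ^+ 2.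
    have ba0 : 0 <= b - a by rewrite subr_ge0 ltW.
    have -> : K ^+ 2 * (b - a) = (Num.sqrt (b - a) * K) ^+ 2.
      by rewrite exprMn sqr_sqrtr// mulrC.
    rewrite lerXn2r ?nnegrE ?mulr_ge0 ?sqrtr_ge0 ?(ltW t0)//.
    by rewrite /t; lra.
  have st1 : 0 <= 1 + s / t by rewrite addr_ge0// divr_ge0// ltW.
  (* With these weights the two bounds add up to exactly [(s + t) ^+ 2]. *)
  apply: (@le_trans _ _ ((1 + s / t) * t ^+ 2 + (1 + t / s) * s ^+ 2)).
    by rewrite lerD2r /B -mulrA ler_wpM2l.
  rewrite le_eqVlt; apply/orP; left; apply/eqP; field.
  by rewrite !gt_eqF.
rewrite /L2norm_on -[X in _ <= X](ger0_norm st0) -sqrtr_sqr ler_wsqrtr//.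
by rewrite -lee_fin fineK// ge0_fin_numE ?(le_lt_trans H) ?ltry//
  integral_ge0// => x _; rewrite lee_fin sqr_ge0.
Qed.

End Identification.

(** * The truncated bound for monotone functions in either direction *)

Section TruncatedBound.
Context {R : realType}.
Notation leb := (@lebesgue_measure R).
Notation I01 := (@I01 R).
Variables (f : R -> R -> R) (x1 tx1 tx2 x2 w1 w2 CF CT cf cW CW : R).
Hypotheses (x1_ge0 : 0 <= x1) (x1_tx1 : x1 < tx1) (tx12 : tx1 < tx2)
  (tx2_x2 : tx2 < x2) (x2_le1 : x2 <= 1)
  (w1_gt0 : 0 < w1) (w12 : w1 < w2) (w2_lt1 : w2 < 1).
Hypotheses (A1 : Assumption1 f x1 x2 w1 w2 CF)
  (A2 : Assumption2 f x1 x2 w1 w2 CT cf cW CW).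

Lemma monotone_on01P (m : R -> R) : monotone_on01 m ->
  measurable_fun I01 m /\ exists B, forall x, I01 x -> `|m x| <= B.
Proof.
case=> [mh|mh].
  split; first exact: nondecreasing01_measurable.
  by exists (pos m 1 + neg m 0); exact: nondecreasing01_bounded.
split; first exact: nonincreasing01_measurable.
exists (pos (fun x => - m x) 1 + neg (fun x => - m x) 0) => x xI.
rewrite -normrN; apply: (nondecreasing01_bounded (m := fun x => - m x)) => //.
by move=> y z yI zI yz; rewrite lerN2 mh.
Qed.

(** A decreasing [m] is replaced by [- m]: absolute values agree, and [Top] only changes sign on the
    unit interval. *)
Lemma truncated_bound (m : R -> R) : monotone_on01 m ->
  exists K, [/\ 0 <= K, forall x, tx1 <= x <= tx2 -> `|m x| <= K &
  Num.sqrt (tx2 - tx1) * K <=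
  Num.sqrt (tx2 - tx1) / Num.min (tx1 - x1) (x2 - tx2) /
  (Num.min (1 - w2) w1 * Num.min (CF - 1) 2 * cW * cf / 4) * L2norm (Top f m)].
Proof.
case: A2 => -[mf [f0 _]] [_ [cf0 [fc [cW0 [_ fWb]]]]].
move=> mono; have [mm [B mB]] := monotone_on01P mono.
have bound := truncated_bound_nondecreasing x1_ge0 x1_tx1 tx12 tx2_x2
  x2_le1 w1_gt0 w12 w2_lt1 mf f0 cW0 fWb A1 cf0 fc.
case: mono => mh; first exact: bound.
have nh : nondecreasing01 (fun x => - m x).
  by move=> y z yI zI yz; rewrite lerN2 mh.
have [K [K0 Km H]] := bound _ nh.
exists K; split; [exact: K0|by move=> x /Km; rewrite normrN|].
suff TN w : I01 w -> Top f (fun x => - m x) w = - Top f m w.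
  have <- : L2norm (Top f (fun x => - m x)) = L2norm (Top f m); last exact: H.
  congr (Num.sqrt (fine _)).
  by apply: eq_integral => w /set_mem wI; rewrite TN// sqrrN.
move=> wI.
have imf : leb.-integrable I01 (EFin \o (fun x => m x * f x w)).
  apply: (@integrable_bounded_mul _ _ _ _ _ _ _ _ B) => //.
    exact: measurable_I01.
  exact: (integrable_section mf f0 cW0 fWb).
rewrite -mulN1r /Top -/(Rintegral leb _ _) -RintegralZl//; last exact: measurable_I01.
by apply: eq_Rintegral => x _; rewrite mulNr mulN1r.
Qed.

Lemma Cbar_ge0 :
  0 <= Num.sqrt (tx2 - tx1) / Num.min (tx1 - x1) (x2 - tx2) /
       (Num.min (1 - w2) w1 * Num.min (CF - 1) 2 * cW * cf / 4).
Proof.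
have CF1 : 1 < CF by case: A1 => _ [].
case: A2 => _ [_ [cf0 [_ [cW0 _]]]].
have d0 : 0 <= Num.min (tx1 - x1) (x2 - tx2) by rewrite le_min !subr_ge0 !ltW.
have mw0 : 0 <= Num.min (1 - w2) w1 by rewrite le_min subr_ge0 !ltW.
have mC0 : 0 <= Num.min (CF - 1) 2 by rewrite le_min subr_ge0 ltW ?ler0n.
apply: divr_ge0; apply: divr_ge0; [exact: sqrtr_ge0|exact: d0| |exact: ler0n].
by apply: mulr_ge0 (ltW cf0); apply: mulr_ge0 (ltW cW0); exact: mulr_ge0.
Qed.

End TruncatedBound.

(** * The operator norm inequality *)

(** Normalising [h] gives a competitor in the supremum. Scalars move through [Top] at almost every
    [w], where the product is integrable, which is enough for the norm. *)
Lemma Top_le_Topnorm (R : realType) (f : R -> R -> R) (h : R -> R) (CT : R) :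
  measurable_fun setT (fun p : R * R => f p.1 p.2) -> inL2 h ->
  (\int[@lebesgue_measure R]_(w in @I01 R)
     (\int[@lebesgue_measure R]_(x in @I01 R) ((f x w) ^+ 2)%:E) <= CT%:E)%E ->
  L2norm h != 0 ->
  ((L2norm (Top f h) / L2norm h)%:E <= Topnorm f)%E.
Proof.
move=> mf hL2 fCT n0; have [mh hfin] := hL2.
set n := L2norm h in n0 *.
have n_gt0 : 0 < n by rewrite lt_neqAle eq_sym n0 sqrtr_ge0.
pose k x := n^-1 * h x.
have mk : measurable_fun (@I01 R) k by exact: measurable_funM.
have kL2 : inL2 k.
  split => //; under eq_integral do rewrite /k exprMn EFinM.
  rewrite ge0_integralZl//.
  - by rewrite lte_mul_pinfty ?lee_fin ?sqr_ge0.
  - exact: measurable_I01.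
  - by apply/measurable_EFinP; exact: measurable_funX.
  - by move=> x _; rewrite lee_fin sqr_ge0.
  - by rewrite lee_fin sqr_ge0.
have k1 : L2norm k = 1 by rewrite L2normZ ?invr_ge0 ?ltW// mulVf.
have -> : L2norm (Top f h) / n = L2norm (Top f k).
  rewrite mulrC -L2normZ ?invr_ge0 ?(ltW n_gt0)//; last first.
    by apply: measurable_funTS; exact: measurable_Top.
  apply: L2norm_ae_eq.
  - by apply: measurable_funM => //; apply: measurable_funTS; exact: measurable_Top.
  - by apply: measurable_funTS; exact: measurable_Top.
  apply: (ae_imply (ae_integrable_product mf hL2 fCT)) => w iw wI.
  rewrite /Top -/(Rintegral _ _ _) -RintegralZl//; last 2 first.
  - exact: measurable_I01.
  - exact: iw.
  by apply: eq_Rintegral => x _; rewrite /k mulrA.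
by apply: ereal_sup_ubound; exists k.
Qed.

Lemma Top_le_Topnorm_mul (R : realType) (f : R -> R -> R) (h : R -> R)
    (C CT : R) :
  0 <= C ->
  measurable_fun setT (fun p : R * R => f p.1 p.2) -> inL2 h ->
  (\int[@lebesgue_measure R]_(w in @I01 R)
     (\int[@lebesgue_measure R]_(x in @I01 R) ((f x w) ^+ 2)%:E) <= CT%:E)%E ->
  ((C * L2norm (Top f h))%:E <= C%:E * Topnorm f * (L2norm h)%:E)%E.
Proof.
move=> C0 mf hL2 fCT; have [mh _] := hL2.
(* A function of norm 0 cannot be normalised; it vanishes almost everywhere, so both sides are 0,
   the right one even for an infinite operator norm. *)
have [n0|n0] := eqVneq (L2norm h) 0.
  have Th0 w : Top f h w = 0.
    rewrite (@Top_ae_eq _ _ _ (cst 0) _ mf mh); last exact: L2norm_eq0.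
      rewrite /Top -/(Rintegral _ _ _) (@eq_Rintegral _ _ _ _ _ (cst 0)).
        by rewrite Rintegral_cst ?mul0r//; exact: measurable_I01.
      by move=> x _; rewrite /= mul0r.
    exact: measurable_cst.
  rewrite n0 mule0 lee_fin /L2norm.
  under eq_integral do rewrite Th0 expr0n.
  by rewrite integral0 /= sqrtr0 mulr0.
rewrite -[L2norm (Top f h)](divfK n0) mulrA !EFinM.
apply: lee_wpmul2r; first by rewrite lee_fin; exact: sqrtr_ge0.
apply: lee_wpmul2l; first by rewrite lee_fin.
by rewrite -EFinM; exact: Top_le_Topnorm fCT n0.
Qed.

(** * Observational equivalence contradicts the norm inequality *)

Unset Implicit Arguments.
Set Strict Implicit.

Theorem theorem4 (R : realType) (f : R -> R -> R)
    (x1 tx1 tx2 x2 w1 w2 CF CT cf cW CW : R) (g' g'' : R -> R) :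
  0 <= x1 -> x1 < tx1 -> tx1 < tx2 -> tx2 < x2 -> x2 <= 1 ->
  0 < w1 -> w1 < w2 -> w2 < 1 ->
  Assumption1 f x1 x2 w1 w2 CF ->
  Assumption2 f x1 x2 w1 w2 CT cf cW CW ->
  inL2 g' -> inL2 g'' ->
  let C1 := Num.sqrt (tx2 - tx1) / Num.min (tx1 - x1) (x2 - tx2) in
  let cp := Num.min (1 - w2) w1 * Num.min (CF - 1) 2 * cW * cf / 4 in
  let Cbar := C1 / cp in
  (exists h : R -> R, inL2 h /\ inM (fun x => g' x - g'' x + h x) /\
     ((L2norm_on tx1 tx2 h)%:E + (Cbar%:E * Topnorm f * (L2norm h)%:E)
        < (L2norm_on tx1 tx2 (fun x => g' x - g'' x))%:E)%E) ->
  ~ {ae (@lebesgue_measure R), forall w, I01 w ->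
        condE f (fun x => g' x - g'' x) w = 0}.
Proof.
move=> x1_ge0 x1_tx1 tx12 tx2_x2 x2_le1 w1_gt0 w12 w2_lt1 A1 A2.
move=> [mg' _] [mg'' _] C1 cp Cbar [h [hL2 [[_ [m [mono gm]]] lt]]] obs.
have [-[mf [f0 _]] [fCT [cf0 [_ [cW0 [_ fWb]]]]]] := A2.
have [mh hfin] := hL2.
have mI := measurable_I01 (R := R).
have [mm [B mB]] := monotone_on01P mono.
have [K [K0 Km KL]] := truncated_bound x1_ge0 x1_tx1 tx12 tx2_x2 x2_le1
  w1_gt0 w12 w2_lt1 A1 A2 mono.
pose g x := g' x - g'' x.
have mg : measurable_fun (@I01 R) g by exact: measurable_funB.
(* Observational equivalence makes [Top f g] vanish almost everywhere, and [g = m - h] almost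
   everywhere. *)
have TmTh : L2norm (Top f m) = L2norm (Top f h).
  apply: L2norm_ae_eq.
  - by apply: measurable_funTS; exact: measurable_Top.
  - by apply: measurable_funTS; exact: measurable_Top.
  apply: (ae_imply2 (ae_integrable_product mf hL2 fCT) obs) => w ih Eg wI.
  have fw := fW_gt0 cW0 fWb wI.
  have imf : lebesgue_measure.-integrable (@I01 R)
      (EFin \o (fun x => m x * f x w)).
    apply: (@integrable_bounded_mul _ _ _ _ _ _ _ _ B) => //.
    exact: (integrable_section mf f0 cW0 fWb).
  have Tg : Top f g w = Top f m w - Top f h w.
    rewrite (@Top_ae_eq _ _ _ (fun x => m x - h x))//.
    - rewrite /Top -/(Rintegral _ _ _) -RintegralB//; last exact: ih.
      by apply: eq_Rintegral => x _; rewrite mulrBl.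
    - exact: measurable_funB.
    by apply: (ae_imply gm) => x H xI; rewrite -(H xI) addrK.
  (* A zero conditional expectation forces [Top f g w = 0] because [fW f w] is positive. *)
  move: (Eg wI) => /eqP; rewrite mulf_eq0 invr_eq0 (gt_eqF fw) orbF -/g Tg.
  by rewrite subr_eq0 => /eqP.
have Cbar0 : 0 <= Cbar by exact: Cbar_ge0 A1 A2.
have key := Top_le_Topnorm_mul Cbar0 mf hL2 fCT.
have sub : `[tx1, tx2]%classic `<=` @I01 R.
  apply: itv_sub_I01; first exact: le_trans x1_ge0 (ltW x1_tx1).
  exact: le_trans (ltW tx2_x2) x2_le1.
(* Triangle inequality for [g = m - h], with the part of [m] bounded by [Cbar] times the norm of
   [Top f m], which equals that of [Top f h]. *)
have : L2norm_on tx1 tx2 g <= L2norm_on tx1 tx2 h + Cbar * L2norm (Top f h).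
  apply: (L2norm_on_triangle tx12 _ _ _ K0 Km).
  - exact: measurable_funS mg.
  - exact: measurable_funS mh.
  - apply: le_lt_trans hfin; apply: ge0_subset_integral.
    + exact: measurable_itv.
    + exact: mI.
    + by apply/measurable_EFinP; exact: measurable_funX.
    + by move=> x _; rewrite lee_fin; exact: sqr_ge0.
    + exact: sub.
  - by apply: (ae_imply gm) => x H /sub/H.
  by rewrite -TmTh; exact: KL.
rewrite -lee_fin EFinD => H.
by have := le_lt_trans (le_trans H (leeD2l _ key)) lt; rewrite ltxx.
Qed.
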